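(* Let $S=C_3x\subset H^*(BP)=\mathbb{F}_2[a,b]$ be the $C_3$-orbit of a homogeneous element $x$, and suppose that $S$ generates a parameter ideal. Then this ideal is Steenrod closed if and only if $C_3x=C_3a^n$ where $n$ is a power of two.
   Context: $P=\mathbb{Z}/2\times\mathbb{Z}/2$, and $H^*(BP)=H^*(BP;\mathbb{F}_2)\cong\mathbb{F}_2[a,b]$ with $|a|=|b|=1$. The cyclic group $C_3$ of order $3$ with generator $\varphi$ acts on $\mathbb{F}_2[a,b]$ by graded ring automorphisms with $\varphi(a)=b$, $\varphi(b)=a+b$. For an element $x$, $C_3x=\{x,\varphi(x),\varphi^2(x)\}$ is its $C_3$-orbit. A parameter ideal is a homogeneous ideal $J$ generated by two homogeneous elements of positive degrees such that $\mathbb{F}_2[a,b]/J$ is finite-dimensional over $\mathbb{F}_2$. The total Steenrod operation is the ring homomorphism $\mathrm{Sq}\colon\mathbb{F}_2[a,b]\to\mathbb{F}_2[a,b]$ with $\mathrm{Sq}(a)=a+a^2$, $\mathrm{Sq}(b)=b+b^2$; a homogeneous ideal $J$ is Steenrod closed if $\mathrm{Sq}(J)\subset J$. Powers of two include $1=2^0$. *)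

(* Defs.v *)
From mathcomp Require Import all_boot all_order all_algebra.
From mathcomp Require Import mpoly.

Set Implicit Arguments.
Unset Strict Implicit.
Unset Printing Implicit Defensive.

Import GRing.Theory.
Local Open Scope ring_scope.

Definition ideal_gen (R : comNzRingType) (s : seq R) (f : R) : Prop :=
  exists c : 'I_(size s) -> R, f = \sum_(i < size s) c i * s`_i.

Notation HBP := {mpoly 'F_2[2]}.

Definition gen_a : HBP := 'X_ord0.
Definition gen_b : HBP := 'X_ord_max.

Definition phi (f : HBP) : HBP := f \mPo [tuple gen_b; gen_a + gen_b].

Definition Sq (f : HBP) : HBP :=
  f \mPo [tuple gen_a + gen_a ^+ 2; gen_b + gen_b ^+ 2].

Lemma phi_a : phi gen_a = gen_b.
Proof. by rewrite /phi comp_mpolyXU -tnth_nth. Qed.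

Lemma phi_b : phi gen_b = gen_a + gen_b.
Proof. by rewrite /phi comp_mpolyXU -tnth_nth. Qed.

Lemma phi_iter3 (f : HBP) : phi (phi (phi f)) = f.
Proof.
have F2 (g : HBP) : g + g = 0.
  rewrite -[g]scale1r -scalerDl.
  have -> : 1 + 1 = 0 :> 'F_2 by apply/eqP.
  exact: scale0r.
have phiD g h : phi (g + h) = phi g + phi h by exact: rmorphD.
have phiZ c g : phi (c *: g) = c *: phi g by exact: comp_mpolyZ.
have phiM g h : phi (g * h) = phi g * phi h by exact: rmorphM.
have phi1 : phi 1 = 1 by exact: rmorph1.
have phiX g n : phi (g ^+ n) = phi g ^+ n by exact: rmorphXn.
have phib : phi (gen_a + gen_b) = gen_a.
  by rewrite phiD phi_a phi_b addrCA F2 addr0.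
have X3 (i : 'I_2) : phi (phi (phi 'X_i)) = 'X_i.
  have [->|->] : i = ord0 \/ i = ord_max.
    by case: i => [[|[|//]] ?]; [left|right]; exact/val_inj.
  - by rewrite -/gen_a phi_a phi_b phib.
  - by rewrite -/gen_b phi_b phib phi_a.
move: phiD phiZ phiM phi1 phiX X3; clear; move: (phi) => u uD uZ uM u1 uX X3.
have XM m : u (u (u 'X_[m])) = 'X_[m].
  rewrite (mpolyXE_id _ m).
  elim/big_ind: _ => [|g h Hg Hh|i _]; first by rewrite !u1.
    by rewrite !uM Hg Hh.
  by rewrite !uX X3.
elim/mpolyind: f => [|c m p _ _ IH].
  by rewrite -[0](scale0r (0 : HBP)) !uZ !scale0r.
by rewrite !uD !uZ IH XM.
Qed.

Lemma Sq_a : Sq gen_a = gen_a + gen_a ^+ 2.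
Proof. by rewrite /Sq comp_mpolyXU -tnth_nth. Qed.

Lemma Sq_b : Sq gen_b = gen_b + gen_b ^+ 2.
Proof. by rewrite /Sq comp_mpolyXU -tnth_nth. Qed.

(* Orbits are compared as sets, i.e. with [=i]. *)
Definition C3orbit (x : HBP) : seq HBP := [:: x; phi x; phi (phi x)].

Definition homogeneous (f : HBP) : Prop := exists d : nat, f \is d.-homog.

(* Finite dimension of F_2[a,b]/J, without forming the quotient:
   the classes of the entries of [s] span the quotient. *)
Definition finite_dim_quotient (J : HBP -> Prop) : Prop :=
  exists s : seq HBP, forall f : HBP,
    exists c : 'I_(size s) -> 'F_2, J (f - \sum_(i < size s) c i *: s`_i).

(* Homogeneity of the ideal is automatic, its generators being homogeneous. *)
Definition parameter_ideal (J : HBP -> Prop) : Prop :=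
  (exists (f g : HBP) (m n : nat),
     [/\ (0 < m)%N, (0 < n)%N, f \is m.-homog, g \is n.-homog
       & forall h : HBP, J h <-> ideal_gen [:: f; g] h])
  /\ finite_dim_quotient J.

Definition Steenrod_closed (J : HBP -> Prop) : Prop :=
  forall f : HBP, J f -> J (Sq f).

(* Main.v *)
From HB Require Import structures.
Require Import Defs.
From mathcomp Require Import all_boot all_order all_algebra.
From mathcomp Require Import mpoly.
From mathcomp Require Import ring zify.

(** If an element [t] of an orbit is the [2^k]-th power of a linear form [l],
    then [Sq t = (l + l^2)^(2^k) = t (1 + t)] by Frobenius, so the ideal
    generated by the orbit of [a^(2^k)] is closed.

    Conversely let [x] have degree [d], put [y = phi x], and let
    [J = (x, phi x, phi^2 x)] be a closed parameter ideal.  As [J] has two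
    generators, its lowest degree part lies in an [F_2]-plane, so that
    [x + phi x + phi^2 x = 0] and [J = (x, y)] ([orbit_sum_eq0]).  As [J]
    has finite codimension, it contains powers of [a] and of [b], so that [x]
    and [y] are coprime ([orbit_common_divisor]).

    For [d > 1] closedness forces [x] to be a square.  The component of degree
    [d + 1] of [Sq x] is [Sq^1 x], with [Sq^1] the derivation
    [a^2 d/da + b^2 d/db]; hence [Sq^1 x = l x + m y] with linear forms [l]
    and [m].  A relation [l x = m y] with linear coefficients is trivial when
    [d > 1] ([linear_independence]), so coefficients can be compared:
    commutation of [Sq^1] with [phi] gives [m = phi l], and then
    [Sq^1 Sq^1 = 0] gives [l = m = 0] ([Sq1_vanishes]).  Now [Sq^1 x = 0]
    together with the Euler formula [a dx/da + b dx/db = d x] leaves two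
    cases.  If [d] is odd, [x] is divisible by [a] and by [a + b], which makes
    [a] a common divisor of [x] and [y].  If [d] is even, both partial
    derivatives vanish and [x = u^2] ([square_of_Sq1_eq0]).

    Since [F_2[a,b]] is free over its subring of squares, with basis
    [1, a, b, ab], closedness of [(u^2, (phi u)^2)] descends to [(u, phi u)]
    ([steen_sqrt]).  Induction on the degree ends with a linear form, and the
    three nonzero linear forms make up the orbit of [a]. *)

Set Implicit Arguments.
Unset Strict Implicit.
Unset Printing Implicit Defensive.

Import GRing.Theory.
Local Open Scope ring_scope.

Local Notation a := gen_a.
Local Notation b := gen_b.
Local Notation hcomp := (pihomog mdeg).
Local Notation "f ^`a" := (f^`M(ord0)) (at level 3, format "f ^`a").
Local Notation "f ^`b" := (f^`M(ord_max)) (at level 3, format "f ^`b").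

(** * Characteristic two, the rotation and the total square *)

Lemma F2_cases (c : 'F_2) : c = 0 \/ c = 1.
Proof. by case: c => [[|[|//]] ?]; [left | right]; apply/val_inj. Qed.

Lemma ord2_cases (i : 'I_2) : i = ord0 \/ i = ord_max.
Proof. by case: i => [[|[|//]] ?]; [left | right]; apply/val_inj. Qed.

Lemma addff (f : HBP) : f + f = 0.
Proof.
rewrite -[f]scale1r -scalerDl; have -> : 1 + 1 = 0 :> 'F_2 by apply/eqP.
exact: scale0r.
Qed.

(** Reduces an identity of characteristic two to one valid in every
    commutative ring, where [r] collects the terms that occur twice. *)
Lemma eq_mod2 (r p q : HBP) : p = q + (r + r) -> p = q.
Proof. by rewrite addff addr0. Qed.

Lemma addf_eq0 (p q : HBP) : p + q = 0 -> p = q.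
Proof.
move=> h; apply: (eq_mod2 (r := - q)).
by rewrite -[LHS]addr0 -(subrr q) addrA h; ring.
Qed.

Lemma sqrfD (f g : HBP) : (f + g) ^+ 2 = f ^+ 2 + g ^+ 2.
Proof. by apply: (eq_mod2 (r := f * g)); ring. Qed.

Lemma mulrn_odd (f : HBP) d : f *+ d = f *+ odd d.
Proof.
rewrite -{1}(odd_double_half d) -mul2n mulrnDr mulrnA mulr2n addff mul0rn.
exact: addr0.
Qed.

(** Scalars are [0] or [1], so the two variables generate the ring under sums
    and products; multiplicative identities need checking on them only. *)
Lemma HBP_ind (P : HBP -> Prop) :
  P 0 -> P 1 -> P a -> P b ->
  (forall f g, P f -> P g -> P (f + g)) ->
  (forall f g, P f -> P g -> P (f * g)) -> forall f, P f.
Proof.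
move=> P0 P1 Pa Pb PD PM; elim/mpolyind => // c m p _ _ Pp.
apply: PD => //; have [->|->] := F2_cases c; first by rewrite scale0r.
rewrite scale1r mpolyXE_id; elim/big_ind: _ => // i _.
elim: (m i) => [|k IH]; first by rewrite expr0.
by rewrite exprS; apply: PM => //; have [->|->] := ord2_cases i.
Qed.

(** [phi] and [Sq] are sealed: they are substitutions, and comparing
    [phi f] with [phi g] by conversion would evaluate them. *)
HB.lock Definition cyc (f : HBP) : HBP := phi f.
HB.lock Definition steen (f : HBP) : HBP := Sq f.

Lemma cycD (f g : HBP) : cyc (f + g) = cyc f + cyc g.
Proof. by rewrite cyc.unlock; apply: rmorphD. Qed.
Lemma cycM (f g : HBP) : cyc (f * g) = cyc f * cyc g.
Proof. by rewrite cyc.unlock; apply: rmorphM. Qed.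
Lemma cycX (f : HBP) k : cyc (f ^+ k) = cyc f ^+ k.
Proof. by rewrite cyc.unlock; apply: rmorphXn. Qed.
Lemma cyc0 : cyc 0 = 0.
Proof. by rewrite cyc.unlock; apply: rmorph0. Qed.
Lemma cyc1 : cyc 1 = 1.
Proof. by rewrite cyc.unlock; apply: rmorph1. Qed.
Lemma cyc_a : cyc a = b.
Proof. by rewrite cyc.unlock phi_a. Qed.
Lemma cyc_b : cyc b = a + b.
Proof. by rewrite cyc.unlock phi_b. Qed.
Lemma cyc_iter3 f : cyc (cyc (cyc f)) = f.
Proof. by rewrite cyc.unlock phi_iter3. Qed.

Lemma SqE f : Sq f = steen f.
Proof. by rewrite steen.unlock. Qed.
Lemma steenD (f g : HBP) : steen (f + g) = steen f + steen g.
Proof. by rewrite steen.unlock; apply: rmorphD. Qed.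
Lemma steenM (f g : HBP) : steen (f * g) = steen f * steen g.
Proof. by rewrite steen.unlock; apply: rmorphM. Qed.
Lemma steenX (f : HBP) k : steen (f ^+ k) = steen f ^+ k.
Proof. by rewrite steen.unlock; apply: rmorphXn. Qed.
Lemma steen0 : steen 0 = 0.
Proof. by rewrite steen.unlock; apply: rmorph0. Qed.
Lemma steen1 : steen 1 = 1.
Proof. by rewrite steen.unlock; apply: rmorph1. Qed.
Lemma steen_a : steen a = a + a ^+ 2.
Proof. by rewrite steen.unlock Sq_a. Qed.
Lemma steen_b : steen b = b + b ^+ 2.
Proof. by rewrite steen.unlock Sq_b. Qed.

Lemma cyc_inj : injective cyc.
Proof.
by apply: (@can_inj _ _ cyc (fun f => cyc (cyc f))) => f; apply: cyc_iter3.
Qed.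

(** * Order and homogeneous components *)

Definition order_ge (k : nat) (f : HBP) : Prop :=
  forall m, (mdeg m < k)%N -> f@_m = 0.

Lemma order_ge0 k : order_ge k 0.
Proof. by move=> m _; rewrite mcoeff0. Qed.

Lemma order_geD k f g : order_ge k f -> order_ge k g -> order_ge k (f + g).
Proof. by move=> hf hg m mk; rewrite mcoeffD hf // hg // addr0. Qed.

Lemma order_geM j k f g :
  order_ge j f -> order_ge k g -> order_ge (j + k) (f * g).
Proof.
move=> hf hg m; rewrite ltnNge => /negP mk; apply: memN_msupp_eq0.
apply/negP => /msuppM_le /allpairsP [[m1 m2] /= [h1 h2 em]]; apply: mk.
rewrite em mdegD leq_add // leqNgt; apply/negP => hlt.
  by move: h1; rewrite mcoeff_msupp hf ?eqxx.
by move: h2; rewrite mcoeff_msupp hg ?eqxx.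
Qed.

Lemma order_geW j k f : (j <= k)%N -> order_ge k f -> order_ge j f.
Proof. by move=> jk hf m mj; apply: hf; apply: leq_trans jk. Qed.

Lemma dhomog_order_ge d (f : HBP) : f \is d.-homog -> order_ge d f.
Proof.
by move=> hf m md; apply: (dhomog_nemf_coeff hf); rewrite ltn_eqF.
Qed.

Lemma hcompE k (f : HBP) m : (hcomp k f)@_m = if mdeg m == k then f@_m else 0.
Proof.
elim/mpolyind: f => [|c n p _ _ IH]; first by rewrite pihomog0 mcoeff0 if_same.
rewrite pihomogD mcoeffD IH linearZ /= pihomogX mcoeffD !mcoeffZ mcoeffX.
have [->|nm] := eqVneq n m.
  by case: ifP; rewrite ?mcoeffX ?eqxx // mcoeff0 mulr0 addr0.
rewrite mulr0 add0r; case: (mdeg n == k); last by rewrite mcoeff0 mulr0 add0r.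
by rewrite mcoeffX (negPf nm) mulr0 add0r.
Qed.

Lemma hcomp_order_ge j k f : order_ge k f -> (j < k)%N -> hcomp j f = 0.
Proof.
move=> hf jk; apply/mpolyP => m; rewrite hcompE mcoeff0.
by case: eqP => // mj; apply: hf; rewrite mj.
Qed.

Lemma hcompM k d (c x : HBP) :
  x \is d.-homog -> hcomp (k + d) (c * x) = hcomp k c * x.
Proof.
move=> hx; elim/mpolyind: c => [|c m p _ _ IH].
  by rewrite mul0r !pihomog0 mul0r.
rewrite mulrDl !pihomogD IH mulrDl -scalerAl !linearZ /= -scalerAl pihomogX.
have hm : 'X_[m] * x \is (mdeg m + d).-homog by rewrite dhomogM ?dhomogX.
congr (_ *: _ + _); case: eqP => [<-|/eqP nm]; first exact: pihomog_dE.
by rewrite mul0r; apply: pihomog_ne0 hm; rewrite eqn_add2r.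
Qed.

Lemma order_ge1 (c : HBP) : c@_0%MM = 0 -> order_ge 1 c.
Proof. by move=> c0 m; rewrite ltnS leqn0 mdeg_eq0 => /eqP->. Qed.

(** The terms of positive degree of [c] only contribute above degree [d]. *)
Lemma hcompM_order d (c f : HBP) :
  order_ge d f -> hcomp d (c * f) = c@_0%MM *: hcomp d f.
Proof.
move=> hf; have -> : c * f = c@_0%MM *: f + (c - (c@_0%MM)%:MP) * f.
  by rewrite mulrBl mul_mpolyC; ring.
have h1 : order_ge 1 (c - (c@_0%MM)%:MP).
  by apply: order_ge1; rewrite mcoeffB mcoeffC eqxx mulr1 subrr.
by rewrite pihomogD linearZ /= (hcomp_order_ge (order_geM h1 hf)) ?addr0.
Qed.

Lemma linear_cases (l : HBP) :
  l \is 1.-homog -> [\/ l = 0, l = a, l = b | l = a + b].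
Proof.
move=> hl; have -> : l = l@_U_(ord0) *: a + l@_U_(ord_max) *: b.
  apply/mpolyP => m; rewrite mcoeffD !mcoeffZ !mcoeffX.
  have [|nm] := eqVneq (mdeg m) 1%N.
    move=> /eqP /mdeg1P [i /eqP ->].
    have [->|->] := ord2_cases i; rewrite !eqxx !mulr1;
    by case: eqP => [/mnmP /(_ ord0)|]; rewrite ?mulr0 ?addr0 ?add0r // !mnm1E.
  have Um i : (U_(i)%MM == m) = false.
    by apply/negP => /eqP em; move: nm; rewrite -em mdeg1.
  by rewrite (dhomog_nemf_coeff hl nm) !Um !mulr0 addr0.
by have [->|->] := F2_cases l@_U_(ord0);
  have [->|->] := F2_cases l@_U_(ord_max);
  rewrite ?scale0r ?scale1r ?addr0 ?add0r; constructor.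
Qed.

Lemma dhomog_a : a \is 1.-homog.
Proof. by rewrite dhomogX; apply/eqP; apply: mdeg1. Qed.
Lemma dhomog_b : b \is 1.-homog.
Proof. by rewrite dhomogX; apply/eqP; apply: mdeg1. Qed.

(** Induction for statements [K d f] on a homogeneous [f] and its degree [d]
    that are additive for fixed [d] and multiplicative with adding degrees. *)
Lemma dhomog_ind (K : nat -> HBP -> Prop) :
  (forall d, K d 0) -> K 0%N 1 -> K 1%N a -> K 1%N b ->
  (forall d f g, K d f -> K d g -> K d (f + g)) ->
  (forall d e f g, K d f -> K e g -> K (d + e)%N (f * g)) ->
  forall d f, f \is d.-homog -> K d f.
Proof.
move=> K0 K1 Ka Kb KD KM d f hf; rewrite [f]mpolyE big_seq.
elim/big_ind: _ => [|g h|m hm]; [exact: K0 | exact: KD |].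
have [->|->] := F2_cases f@_m; first by rewrite scale0r.
rewrite scale1r -(dhomog_mf hf hm) mpolyXE_id /= mdegE.
elim/big_ind2: _ => [||i _] //; first by move=> *; apply: KM.
elim: (m i) => [|k IH]; first by rewrite expr0.
by rewrite exprS -add1n; apply: KM => //; have [->|->] := ord2_cases i.
Qed.

Lemma cyc_dhomog d (f : HBP) : f \is d.-homog -> cyc f \is d.-homog.
Proof.
move: d f; apply: dhomog_ind => [d||||d f g hf hg|d e f g hf hg].
- by rewrite cyc0 rpred0.
- by rewrite cyc1 dhomog1.
- by rewrite cyc_a dhomog_b.
- by rewrite cyc_b rpredD ?dhomog_a ?dhomog_b.
- by rewrite cycD; apply: rpredD.
- by rewrite cycM dhomogM.
Qed.

(** * The first Steenrod square *)

Lemma mderiv_gens : [/\ a^`a = 1, a^`b = 0, b^`a = 0 & b^`b = 1].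
Proof.
by split; rewrite /gen_a /gen_b mderivX mnm1E ?eqxx ?scale0r //
  scale1r -mpolyX0; congr 'X_[_]; apply/mnmP => i; rewrite mnmBE subnn mnm0E.
Qed.

Lemma mderiv_sqr i (f : HBP) : (f ^+ 2)^`M(i) = 0.
Proof. by rewrite expr2 mderivM mulrC addff. Qed.

(** The operation [Sq^1]: the derivation that squares each linear form. *)
HB.lock Definition Sq1 (f : HBP) : HBP := a ^+ 2 * f^`a + b ^+ 2 * f^`b.

Lemma Sq1E f : Sq1 f = a ^+ 2 * f^`a + b ^+ 2 * f^`b.
Proof. by rewrite Sq1.unlock. Qed.

Lemma Sq1D f g : Sq1 (f + g) = Sq1 f + Sq1 g.
Proof. by rewrite !Sq1E !mderivD; ring. Qed.

Lemma Sq1M f g : Sq1 (f * g) = Sq1 f * g + f * Sq1 g.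
Proof. by rewrite !Sq1E !mderivM; ring. Qed.

Lemma Sq1_0 : Sq1 0 = 0.
Proof. by rewrite !Sq1E !mderiv0; ring. Qed.

Lemma Sq1_1 : Sq1 1 = 0.
Proof. by rewrite Sq1E -mpolyC1 !mderivC; ring. Qed.

Lemma Sq1_a : Sq1 a = a ^+ 2.
Proof. by rewrite Sq1E; have [-> -> _ _] := mderiv_gens; ring. Qed.

Lemma Sq1_b : Sq1 b = b ^+ 2.
Proof. by rewrite Sq1E; have [_ _ -> ->] := mderiv_gens; ring. Qed.

Lemma Sq1_sqr f : Sq1 (f ^+ 2) = 0.
Proof. by rewrite !Sq1E !mderiv_sqr; ring. Qed.

Lemma Sq1_linear l : l \is 1.-homog -> Sq1 l = l ^+ 2.
Proof.
by case/linear_cases => ->; rewrite ?Sq1D ?Sq1_0 ?Sq1_a ?Sq1_b ?sqrfD ?expr0n.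
Qed.

(** The square of a derivation [D] satisfies
    [D^2(fg) = D^2 f g + 2 Df Dg + f D^2 g], hence is again a derivation in
    characteristic two; this one kills both variables. *)
Lemma Sq1_Sq1 f : Sq1 (Sq1 f) = 0.
Proof.
elim/HBP_ind: f => [||||f g hf hg|f g hf hg].
- by rewrite !Sq1_0.
- by rewrite Sq1_1 Sq1_0.
- by rewrite Sq1_a Sq1_sqr.
- by rewrite Sq1_b Sq1_sqr.
- by rewrite 2!Sq1D hf hg addr0.
- rewrite Sq1M Sq1D 2!Sq1M hf hg.
  by apply: (eq_mod2 (r := Sq1 f * Sq1 g)); ring.
Qed.

Lemma Sq1_cyc f : Sq1 (cyc f) = cyc (Sq1 f).
Proof.
elim/HBP_ind: f => [||||f g hf hg|f g hf hg].
- by rewrite Sq1_0 !cyc0 Sq1_0.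
- by rewrite Sq1_1 cyc1 cyc0 Sq1_1.
- by rewrite cyc_a Sq1_a Sq1_b cycX cyc_a.
- by rewrite cyc_b Sq1D Sq1_a Sq1_b cycX cyc_b sqrfD.
- by rewrite cycD 2!Sq1D cycD hf hg.
- by rewrite cycM 2!Sq1M cycD 2!cycM hf hg.
Qed.

Lemma euler d f : f \is d.-homog -> a * f^`a + b * f^`b = f *+ d.
Proof.
move: d f; have [aa ab ba bb] := mderiv_gens.
apply: dhomog_ind => [d||||d f g hf hg|d e f g hf hg].
- by rewrite !mderiv0 mul0rn; ring.
- by rewrite -mpolyC1 !mderivC; ring.
- by rewrite aa ab; ring.
- by rewrite ba bb; ring.
- by rewrite !mderivD mulrnDl -hf -hg; ring.
- by rewrite !mderivM mulrnDr -mulrnAl -mulrnAr -hf -hg; ring.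
Qed.

(** [Sq x = x + Sq^1 x] up to terms of degree at least [d + 2].  The two
    homogeneity clauses are what the induction on products needs. *)
Lemma Sq1_lowest d x : x \is d.-homog ->
  [/\ x \is d.-homog, Sq1 x \is d.+1.-homog &
    order_ge d.+2 (steen x - (x + Sq1 x))].
Proof.
move: d x; apply: dhomog_ind => [d||||d f g|d e f g].
- rewrite Sq1_0 !addr0 subr0 !rpred0 steen0; split=> //; exact: order_ge0.
- rewrite Sq1_1 steen1 addr0 subrr.
  by split; [exact: dhomog1 | exact: rpred0 | exact: order_ge0].
- rewrite Sq1_a steen_a subrr; split; [exact: dhomog_a | | exact: order_ge0].
  exact: (dhomogMn 2 dhomog_a).
- rewrite Sq1_b steen_b subrr; split; [exact: dhomog_b | | exact: order_ge0].
  exact: (dhomogMn 2 dhomog_b).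
- move=> [f1 f2 f3] [g1 g2 g3]; rewrite Sq1D steenD.
  split; [exact: rpredD | exact: rpredD |].
  by have := order_geD f3 g3; congr order_ge; ring.
- move=> [f1 f2 f3] [g1 g2 g3]; split.
  + exact: dhomogM.
  + rewrite Sq1M; apply: rpredD; [rewrite -addSn | rewrite -addnS];
      exact: dhomogM.
  (* Expand the product of the two expansions and sort its terms by order. *)
  have -> : steen (f * g) - (f * g + Sq1 (f * g)) =
      (steen f - (f + Sq1 f)) * (steen g - (g + Sq1 g))
    + ((steen f - (f + Sq1 f)) * g + f * (steen g - (g + Sq1 g)))
    + ((steen f - (f + Sq1 f)) * Sq1 g + Sq1 f * (steen g - (g + Sq1 g)))
    + Sq1 f * Sq1 g.
    by rewrite steenM Sq1M; ring.
  have le k l : ((d + e).+2 <= k + l)%N ->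
    forall p q : HBP, order_ge k p -> order_ge l q ->
      order_ge (d + e).+2 (p * q).
    by move=> h p q hp hq; apply: order_geW (order_geM hp hq).
  move/dhomog_order_ge: f1 => f1; move/dhomog_order_ge: f2 => f2.
  move/dhomog_order_ge: g1 => g1; move/dhomog_order_ge: g2 => g2.
  apply: order_geD; [apply: order_geD; [apply: order_geD|]|].
  + by apply: (le d.+2 e.+2) => //; lia.
  + by apply: order_geD; [apply: (le d.+2 e) | apply: (le d e.+2)] => //; lia.
  + by apply: order_geD; [apply: (le d.+2 e.+1) | apply: (le d.+1 e.+2)] => //;
      lia.
  + by apply: (le d.+1 e.+1) => //; lia.
Qed.

(** * Divisibility by linear forms *)

(** Reduction modulo [a]; its kernel is the ideal [(a)], which is therefore
    prime. *)
HB.lock Definition kill_a (f : HBP) : HBP := f \mPo [tuple 0; b].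

Lemma kill_aD f g : kill_a (f + g) = kill_a f + kill_a g.
Proof. by rewrite kill_a.unlock; apply: rmorphD. Qed.
Lemma kill_aM f g : kill_a (f * g) = kill_a f * kill_a g.
Proof. by rewrite kill_a.unlock; apply: rmorphM. Qed.
Lemma kill_aX f k : kill_a (f ^+ k) = kill_a f ^+ k.
Proof. by rewrite kill_a.unlock; apply: rmorphXn. Qed.
Lemma kill_a0 : kill_a 0 = 0.
Proof. by rewrite kill_a.unlock; apply: rmorph0. Qed.
Lemma kill_a1 : kill_a 1 = 1.
Proof. by rewrite kill_a.unlock; apply: rmorph1. Qed.
Lemma kill_a_a : kill_a a = 0.
Proof. by rewrite kill_a.unlock comp_mpolyXU -tnth_nth. Qed.
Lemma kill_a_b : kill_a b = b.
Proof. by rewrite kill_a.unlock comp_mpolyXU -tnth_nth. Qed.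

Lemma a_neq0 : a != 0.
Proof. by rewrite -msupp_eq0 msuppX. Qed.
Lemma b_neq0 : b != 0.
Proof. by rewrite -msupp_eq0 msuppX. Qed.

Lemma kill_aP f : exists g, f = kill_a f + a * g.
Proof.
elim/HBP_ind: f => [||||f g [u hu] [v hv]|f g [u hu] [v hv]].
- by exists 0; rewrite kill_a0; ring.
- by exists 0; rewrite kill_a1; ring.
- by exists 1; rewrite kill_a_a; ring.
- by exists 0; rewrite kill_a_b; ring.
- by exists (u + v); rewrite kill_aD {1}hu {1}hv; ring.
- exists (u * kill_a g + kill_a f * v + a * u * v).
  by rewrite kill_aM {1}hu {1}hv; ring.
Qed.

Lemma kill_a_dvd f : kill_a f = 0 -> exists g, f = a * g.
Proof. by have [g e] := kill_aP f => f0; exists g; rewrite {1}e f0 add0r. Qed.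

Lemma gens_distinct : [/\ a != b, a + b != 0 & a + b != b].
Proof.
have ab : a != b.
  apply/eqP => e; have := kill_a_b; rewrite -e kill_a_a => /esym/eqP.
  by rewrite (negPf a_neq0).
split=> //.
- by apply: contraNneq ab => /addf_eq0->.
- by rewrite -subr_eq0 addrK a_neq0.
Qed.

Lemma a_dvd_cancel (l f g : HBP) :
  l \is 1.-homog -> l != 0 -> l != a -> l * f = a * g -> exists h, f = a * h.
Proof.
move=> hl l0 la /(congr1 kill_a); rewrite !kill_aM kill_a_a mul0r => /eqP.
have kl : kill_a l = b.
  case: (linear_cases hl) l0 la => ->; rewrite ?eqxx // => _ _.
    exact: kill_a_b.
  by rewrite kill_aD kill_a_a kill_a_b add0r.
by rewrite kl mulf_eq0 (negPf b_neq0) /= => /eqP; apply: kill_a_dvd.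
Qed.

Lemma cyc_eq0 f : (cyc f == 0) = (f == 0).
Proof. by rewrite -[in LHS]cyc0 (inj_eq cyc_inj). Qed.

(** Distinct nonzero linear forms are coprime.  The rotation permutes the three
    of them transitively, which reduces the claim to the divisor [a]. *)
Lemma linear_dvd_cancel (l m f g : HBP) :
  l \is 1.-homog -> m \is 1.-homog -> l != 0 -> m != 0 -> m != l ->
  m * f = l * g -> exists h, f = l * h.
Proof.
move=> hl hm l0 m0; case: (linear_cases hl) l0 => ->;
  rewrite ?eqxx // => _ ml e.
- exact: a_dvd_cancel e.
(* The second rotate of [b] is [a]; for [a + b] the first rotate is. *)
- have [||||h eh] := @a_dvd_cancel (cyc (cyc m)) (cyc (cyc f)) (cyc (cyc g)).
  + by rewrite !cyc_dhomog.
  + by rewrite !cyc_eq0.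
  + by apply: contra_neq ml => /(congr1 cyc); rewrite cyc_iter3 cyc_a.
  + by rewrite -!cycM e !cycM -cyc_a cyc_iter3.
  by exists (cyc h); rewrite -[f]cyc_iter3 eh cycM cyc_a.
- have cab : cyc (a + b) = a.
    by rewrite cycD cyc_a cyc_b; apply: (eq_mod2 (r := b)); ring.
  have [||||h eh] := @a_dvd_cancel (cyc m) (cyc f) (cyc g).
  + by rewrite !cyc_dhomog.
  + by rewrite !cyc_eq0.
  + by apply: contra_neq ml => ma; apply: cyc_inj; rewrite cab.
  + by rewrite -cycM e cycM cab.
  by exists (cyc (cyc h)); rewrite -[f]cyc_iter3 eh !cycM cyc_a cyc_b.
Qed.

Definition is_coprime (f g : HBP) : Prop :=
  forall w p q, f = w * p -> g = w * q -> exists v, w * v = 1.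

Lemma dhomog_order_gt_eq0 d k (f : HBP) :
  f \is d.-homog -> order_ge k f -> (d < k)%N -> f = 0.
Proof. by move=> hf ok dk; rewrite -(pihomog_dE hf) (hcomp_order_ge ok). Qed.

Lemma order_ge_mulr k (f g : HBP) : order_ge k f -> order_ge k (f * g).
Proof.
by move=> hf; rewrite -[k]addn0; apply: order_geM => // m; rewrite ltn0.
Qed.

Lemma not_unit d (f v : HBP) : f \is d.-homog -> (0 < d)%N -> f * v <> 1.
Proof.
move=> /dhomog_order_ge hf d0 e.
have o : order_ge d 1 by rewrite -e; apply: order_ge_mulr.
by have /eqP := dhomog_order_gt_eq0 (dhomog1 _ _) o d0; rewrite oner_eq0.
Qed.

Lemma coprime_cyc_neq0 x : is_coprime x (cyc x) -> x != 0.
Proof.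
move=> cop; apply/eqP => x0.
have [||v /eqP] := cop 0 0 0; rewrite ?x0 ?cyc0 ?mul0r //.
by rewrite eq_sym oner_eq0.
Qed.

(** In a relation [l x = m (phi x)] with [l], [m] distinct and nonzero, [l]
    divides [phi x], so [phi x = l w] and [x = m w].  Coprimality makes [w] a
    unit, and then [m] would be a multiple of [x], of degree [d > 1].  For
    [l = m] the common divisor is [x] itself. *)
Lemma linear_independence d x l m :
  (1 < d)%N -> x \is d.-homog -> is_coprime x (cyc x) ->
  l \is 1.-homog -> m \is 1.-homog -> l * x + m * cyc x = 0 ->
  l = 0 /\ m = 0.
Proof.
move=> d1 hx cop hl hm /addf_eq0 e.
have x0 := coprime_cyc_neq0 cop.
have [l0|l0] := eqVneq l 0.
  split=> //; move/eqP: e; rewrite l0 mul0r eq_sym mulf_eq0 cyc_eq0.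
  by rewrite (negPf x0) orbF => /eqP.
have [m0|m0] := eqVneq m 0.
  by move/eqP: e; rewrite m0 mul0r mulf_eq0 (negPf l0) (negPf x0).
have [ml|ml] := eqVneq m l.
  move: e; rewrite ml => /(mulfI l0) e.
  have [v] := cop x 1 1 (esym (mulr1 _)) (etrans (esym e) (esym (mulr1 _))).
  by move/(not_unit hx) => []; apply: ltnW.
have [w ew] := linear_dvd_cancel hl hm l0 m0 ml (esym e).
have exw : x = m * w by apply: (mulfI l0); rewrite e ew; ring.
have [v wv] := cop w m l (etrans exw (mulrC _ _)) (etrans ew (mulrC _ _)).
have em : m = x * v by rewrite exw -mulrA wv mulr1.
have o : order_ge d m by rewrite em; apply/order_ge_mulr/dhomog_order_ge.
by have /eqP := dhomog_order_gt_eq0 hm o d1; rewrite (negPf m0).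
Qed.

(** * Vanishing of the first square on the generators *)

Lemma cyc_cyc_linear (l : HBP) : l \is 1.-homog -> cyc (cyc l) = l + cyc l.
Proof.
case/linear_cases => ->; rewrite ?cycD ?cyc0 ?cyc_a ?cyc_b ?cycD ?cyc_a ?cyc_b.
- by rewrite addr0.
- by [].
- by rewrite addrCA.
- by apply: (eq_mod2 (r := 0)); ring.
Qed.

Lemma Sq1_coeffs d x p q :
  x \is d.-homog -> steen x = p * x + q * cyc x ->
  Sq1 x = hcomp 1 p * x + hcomp 1 q * cyc x.
Proof.
move=> hx e; have [_ hS ho] := Sq1_lowest hx.
rewrite -!(@hcompM 1 d) ?cyc_dhomog // -pihomogD -e add1n.
have -> : steen x = x + Sq1 x + (steen x - (x + Sq1 x)) by ring.
rewrite pihomogD (hcomp_order_ge ho) // pihomogD (pihomog_dE hS).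
by rewrite (pihomog_ne0 _ hx) ?add0r ?addr0 // ltn_eqF.
Qed.

(** The rotates of [Sq^1 x = l x + m (phi x)] add up to zero, since those of
    [x] do.  Comparing the coefficients of [x] gives [m = phi l], and applying
    [Sq^1] once more gives
    [phi l ((l + phi l) x + phi l (phi x)) = 0], whence [phi l = 0]. *)
Lemma Sq1_vanishes d x p q :
  (1 < d)%N -> x \is d.-homog -> x + cyc x + cyc (cyc x) = 0 ->
  is_coprime x (cyc x) -> steen x = p * x + q * cyc x -> Sq1 x = 0.
Proof.
move=> d1 hx tr cop e.
have LI := linear_independence d1 hx cop.
have hl : hcomp 1 p \is 1.-homog by apply: pihomogP.
have hm : hcomp 1 q \is 1.-homog by apply: pihomogP.
move: (Sq1_coeffs hx e) hl hm; move: (hcomp 1 p) (hcomp 1 q) => l m Sx hl hm.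
have ccl := cyc_cyc_linear hl; have ccm := cyc_cyc_linear hm.
have ccx : cyc (cyc x) = x + cyc x by rewrite -(addf_eq0 tr).
have Sy : Sq1 (cyc x) = cyc l * cyc x + cyc m * (x + cyc x).
  by rewrite Sq1_cyc Sx cycD !cycM ccx.
have Sz : Sq1 (x + cyc x) = (l + cyc l) * (x + cyc x) + (m + cyc m) * x.
  by rewrite -{1}ccx Sq1_cyc Sy cycD !cycM -ccx cyc_iter3 ccl ccm.
have [em _] : cyc l + m = 0 /\ m + cyc m + l = 0.
  apply: LI; rewrite ?rpredD ?cyc_dhomog //.
  have : Sq1 x + Sq1 (cyc x) + Sq1 (x + cyc x) = 0 by rewrite Sq1D addff.
  rewrite Sx Sy Sz => s0; rewrite -[RHS]s0.
  apply: (eq_mod2 (r := - (l * x) - cyc l * cyc x - cyc m * x)).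
  ring.
have {}em : m = cyc l by rewrite -(addf_eq0 em).
have : Sq1 (l * x + m * cyc x) = 0 by rewrite -Sx Sq1_Sq1.
rewrite Sq1D 2!Sq1M Sy Sx (Sq1_linear hl) (Sq1_linear hm) em ccl => s0.
have {s0} /eqP : cyc l * ((l + cyc l) * x + cyc l * cyc x) = 0.
  rewrite -[RHS]s0.
  by apply: (eq_mod2
    (r := - (l ^+ 2 * x + l * cyc l * cyc x + cyc l ^+ 2 * cyc x))); ring.
have cl0 : cyc l = 0 -> l * x + cyc l * cyc x = 0.
  move=> c0; have l0 : l = 0 by apply: cyc_inj; rewrite cyc0.
  by rewrite c0 l0 !mul0r addr0.
rewrite mulf_eq0 => /orP [/eqP s0|/eqP s0]; first exact: cl0.
by apply: cl0; have [] := LI _ _ _ _ s0; rewrite ?rpredD ?cyc_dhomog.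
Qed.

(** * Square roots *)

(** The generation half of the fact that [1, a, b, ab] is a basis of the ring
    over its subring of squares; [square_decomp0] is the independence. *)
Lemma square_decomp (f : HBP) : exists f0 f1 f2 f3,
  f = f0 ^+ 2 + a * f1 ^+ 2 + b * f2 ^+ 2 + a * b * f3 ^+ 2.
Proof.
elim/HBP_ind: f => [||||f g [f0][f1][f2][f3] -> [g0][g1][g2][g3] ->
                        |f g [f0][f1][f2][f3] -> [g0][g1][g2][g3] ->].
- by exists 0, 0, 0, 0; ring.
- by exists 1, 0, 0, 0; ring.
- by exists 0, 1, 0, 0; ring.
- by exists 0, 0, 1, 0; ring.
- by exists (f0 + g0), (f1 + g1), (f2 + g2), (f3 + g3); rewrite !sqrfD; ring.
- exists (f0 * g0 + a * (f1 * g1) + b * (f2 * g2) + a * b * (f3 * g3)).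
  exists (f0 * g1 + f1 * g0 + b * (f2 * g3) + b * (f3 * g2)).
  exists (f0 * g2 + f2 * g0 + a * (f1 * g3) + a * (f3 * g1)).
  exists (f0 * g3 + f3 * g0 + f1 * g2 + f2 * g1).
  by rewrite !sqrfD; ring.
Qed.

Lemma mderiv_mulsqr i (f g : HBP) : (g * f ^+ 2)^`M(i) = g^`M(i) * f ^+ 2.
Proof. by rewrite mderivM mderiv_sqr mulr0 addr0. Qed.

Lemma mderiv_square_decomp f0 f1 f2 f3
  (f := f0 ^+ 2 + a * f1 ^+ 2 + b * f2 ^+ 2 + a * b * f3 ^+ 2 : HBP) :
  f^`a = f1 ^+ 2 + b * f3 ^+ 2 /\ f^`b = f2 ^+ 2 + a * f3 ^+ 2.
Proof.
have [aa ab ba bb] := mderiv_gens.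
rewrite /f !mderivD !mderiv_sqr !mderiv_mulsqr !mderivM aa ab ba bb.
by split; ring.
Qed.

Lemma square_of_mderiv0 (f : HBP) :
  f^`a = 0 -> f^`b = 0 -> exists u, f = u ^+ 2.
Proof.
have [f0 [f1 [f2 [f3 ->]]]] := square_decomp f.
have [-> ->] := mderiv_square_decomp f0 f1 f2 f3 => ha hb.
have [_ _ _ bb] := mderiv_gens.
have f30 : f3 ^+ 2 = 0.
  have := congr1 (mderiv ord_max) ha.
  rewrite mderiv0 mderivD mderiv_sqr mderiv_mulsqr bb => <-; ring.
exists f0; move: ha hb; rewrite f30 !mulr0 !addr0 => -> ->.
by rewrite !mulr0 !addr0.
Qed.

Lemma square_decomp0 (f0 f1 f2 f3 : HBP) :
  f0 ^+ 2 + a * f1 ^+ 2 + b * f2 ^+ 2 + a * b * f3 ^+ 2 = 0 :> HBP -> f0 = 0.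
Proof.
move=> e; have [] := mderiv_square_decomp f0 f1 f2 f3.
rewrite e !mderiv0 => ha hb.
have [_ _ _ bb] := mderiv_gens.
have f30 : f3 ^+ 2 = 0.
  have := congr1 (mderiv ord_max) ha.
  rewrite mderiv0 mderivD mderiv_sqr mderiv_mulsqr bb => ->; ring.
move: ha hb e; rewrite f30 !mulr0 !addr0 => <- <-; rewrite !mulr0 !addr0.
by move/eqP; rewrite sqrf_eq0 => /eqP.
Qed.

(** The equations [a^2 x_a + b^2 x_b = 0] and [a x_a + b x_b = d x] have
    determinant [ab (a + b)] in the partial derivatives [x_a], [x_b].  For [d]
    even this kills both.  For [d] odd they give [b x = a (a + b) x_a], so
    that [a] and [a + b] divide [x]; as [phi (a + b) = a], the form [a] also
    divides [phi x]. *)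
Lemma square_of_Sq1_eq0 d x :
  x \is d.-homog -> is_coprime x (cyc x) -> Sq1 x = 0 ->
  exists u, x = u ^+ 2.
Proof.
move=> hx cop; rewrite Sq1E => S0; have E := euler hx.
have [ab abn0 abb] := gens_distinct.
have [odd_d|even_d] := boolP (odd d).
  have Ex : a * x^`a + b * x^`b = x by rewrite E mulrn_odd odd_d.
  have bx : b * x = a * ((a + b) * x^`a).
    rewrite -{1}Ex; apply: (eq_mod2 (r := b ^+ 2 * x^`b)).
    by rewrite -[LHS]addr0 -S0; ring.
  have ba : b != a by rewrite eq_sym.
  have hab : a + b \is 1.-homog by rewrite rpredD ?dhomog_a ?dhomog_b.
  have [v ev] := a_dvd_cancel dhomog_b b_neq0 ba bx.
  have [||w ew] := @linear_dvd_cancel _ _ x (a * x^`a) hab dhomog_b abn0 b_neq0.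
  - by rewrite eq_sym.
  - by rewrite bx; ring.
  have [|u] := cop a v (cyc w) ev.
    by rewrite ew cycM cycD cyc_a cyc_b addrCA addff addr0.
  by move/(not_unit dhomog_a isT).
have {}E : a * x^`a = b * x^`b.
  by apply: addf_eq0; rewrite E mulrn_odd (negPf even_d).
have xb : x^`b = 0.
  have /eqP : b * (a + b) * x^`b = 0.
    by rewrite -[RHS]S0 !expr2 -(mulrA a) E; ring.
  by rewrite !mulf_eq0 (negPf b_neq0) (negPf abn0) => /eqP.
have /eqP : a * x^`a = 0 by rewrite E xb mulr0.
rewrite mulf_eq0 (negPf a_neq0) => /eqP xa.
exact: square_of_mderiv0 xa xb.
Qed.

Lemma coprime_sqrt u :
  is_coprime (u ^+ 2) (cyc (u ^+ 2)) -> is_coprime u (cyc u).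
Proof.
move=> cop w p q eu ecu.
have [||v e] := cop (w ^+ 2) (p ^+ 2) (q ^+ 2).
- by rewrite eu exprMn.
- by rewrite cycX ecu exprMn.
by exists (w * v); rewrite -e; ring.
Qed.

(** Take the part along the basis element [1] of the relation
    [(Sq u)^2 = p u^2 + q (phi u)^2]: it is a relation between squares, so its
    square root can be extracted. *)
Lemma steen_sqrt u p q : steen (u ^+ 2) = p * u ^+ 2 + q * cyc (u ^+ 2) ->
  exists p' q', steen u = p' * u + q' * cyc u.
Proof.
have [p0 [p1 [p2 [p3 ->]]]] := square_decomp p.
have [q0 [q1 [q2 [q3 ->]]]] := square_decomp q.
rewrite steenX cycX => e; exists p0, q0; apply: addf_eq0.
apply: (@square_decomp0 _ (p1 * u + q1 * cyc u) (p2 * u + q2 * cyc u)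
  (p3 * u + q3 * cyc u)).
rewrite !sqrfD e.
by apply: (eq_mod2 (r :=
  (p0 ^+ 2 + a * p1 ^+ 2 + b * p2 ^+ 2 + a * b * p3 ^+ 2) * u ^+ 2 +
  (q0 ^+ 2 + a * q1 ^+ 2 + b * q2 ^+ 2 + a * b * q3 ^+ 2) * cyc u ^+ 2)); ring.
Qed.

(** Squaring doubles exponents and fixes coefficients, by Frobenius and
    [c^2 = c] in [F_2]. *)
Lemma mcoeff_sqr (u : HBP) m : (u ^+ 2)@_(m + m) = u@_m.
Proof.
elim/mpolyind: u => [|c n p _ _ IH]; first by rewrite expr0n !mcoeff0.
rewrite sqrfD !mcoeffD IH exprZn (expr2 'X_[n]) -mpolyXD !mcoeffZ !mcoeffX.
have -> : (n + n == m + m)%MM = (n == m).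
  apply/eqP/eqP => [/mnmP e|->] //; apply/mnmP => i.
  by have := e i; rewrite !mnmDE; lia.
by have [->|->] := F2_cases c; rewrite ?expr0n ?expr1n ?mul0r.
Qed.

Lemma dhomog_sqrt d (u : HBP) : u ^+ 2 \is d.-homog -> u \is (d./2).-homog.
Proof.
move=> hu; apply/dhomogP => m /=.
rewrite mcoeff_msupp -mcoeff_sqr -mcoeff_msupp.
by move/(dhomog_mf hu) => /= <-; rewrite mdegD addnn doubleK.
Qed.

(** Descent on the degree: above degree one every solution is the square of a
    solution of half the degree. *)
Lemma closed_orbit_power d x p q : (0 < d)%N -> x \is d.-homog ->
  x + cyc x + cyc (cyc x) = 0 -> is_coprime x (cyc x) ->
  steen x = p * x + q * cyc x ->
  exists l k, [/\ l \is 1.-homog, l != 0 & x = l ^+ (2 ^ k)].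
Proof.
elim/ltn_ind: d x p q => d IH x p q d0 hx tr cop e.
have [d1|d1] := ltnP 1 d; last first.
  have d_1 : d = 1%N by lia.
  by subst d; exists x, 0%N; rewrite (coprime_cyc_neq0 cop).
have S0 := Sq1_vanishes d1 hx tr cop e.
have [u eu] := square_of_Sq1_eq0 hx cop S0; subst x.
have [p' [q' e']] := steen_sqrt e.
have [|||l [k [hl l0 el]]] :=
  IH d./2 _ u p' q' _ (dhomog_sqrt hx) _ (coprime_sqrt cop) e'.
- lia.
- lia.
- by apply/eqP; rewrite -sqrf_eq0 !sqrfD -!cycX tr.
by exists l, k.+1; split=> //; rewrite el -exprM -expnSr.
Qed.

(** * The ideal generated by an orbit *)

Lemma C3orbitE x : C3orbit x = [:: x; cyc x; cyc (cyc x)].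
Proof. by rewrite cyc.unlock. Qed.

Lemma C3orbit_cyc x : C3orbit (cyc x) =i C3orbit x.
Proof. by move=> y; rewrite !C3orbitE cyc_iter3 !inE orbA orbC. Qed.

Lemma ideal_gen0 (s : seq HBP) : ideal_gen s 0.
Proof. by exists (fun=> 0); rewrite big1 // => i _; rewrite mul0r. Qed.

Lemma ideal_genD (s : seq HBP) f g :
  ideal_gen s f -> ideal_gen s g -> ideal_gen s (f + g).
Proof.
move=> [c ->] [e ->]; exists (fun i => c i + e i); rewrite -big_split /=.
by apply: eq_bigr => i _; rewrite mulrDl.
Qed.

Lemma ideal_genM (s : seq HBP) f g : ideal_gen s f -> ideal_gen s (g * f).
Proof.
move=> [c ->]; exists (fun i => g * c i); rewrite mulr_sumr.
by apply: eq_bigr => i _; rewrite mulrA.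
Qed.

Lemma ideal_gen_mem (s : seq HBP) f : f \in s -> ideal_gen s f.
Proof.
move=> fs; have fi : (index f s < size s)%N by rewrite index_mem.
exists (fun i => if i == Ordinal fi then 1 else 0).
rewrite (bigD1 (Ordinal fi)) //= eqxx mul1r nth_index // big1 ?addr0 //.
by move=> i /negPf ->; rewrite mul0r.
Qed.

Lemma ideal_gen2P (f g h : HBP) :
  ideal_gen [:: f; g] h -> exists p q, h = p * f + q * g.
Proof.
by case=> c ->; rewrite !big_ord_recl big_ord0 /= addr0; do 2!eexists.
Qed.

Lemma ideal_gen3P (f g k h : HBP) :
  ideal_gen [:: f; g; k] h -> exists p q r, h = p * f + q * g + r * k.
Proof.
by case=> c ->; rewrite !big_ord_recl big_ord0 /= addr0 addrA; do 3!eexists.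
Qed.

Lemma order_ge_ideal k s f :
  (forall g, g \in s -> order_ge k g) -> ideal_gen s f -> order_ge k f.
Proof.
move=> hs [c ->]; elim/big_ind: _ => [|g h|i _].
- exact: order_ge0.
- exact: order_geD.
- by rewrite mulrC; apply/order_ge_mulr/hs/mem_nth.
Qed.

(** The hypothesis places [x], [y], [z] in the [F_2]-span of [F] and [G]; three
    distinct nonzero vectors there are all the nonzero vectors of a plane. *)
Lemma sum_span2 (F G x y z : HBP) :
  (forall t, t \in [:: x; y; z] -> t \in [:: 0; F; G; F + G]) ->
  x != 0 -> y != 0 -> z != 0 -> x != y -> y != z -> z != x -> x + y + z = 0.
Proof.
move=> h x0 y0 z0 xy yz zx.
have := h x (mem_head _ _); have := h y; have := h z.
rewrite !inE !eqxx !orbT => /(_ isT) + /(_ isT).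
rewrite (negPf x0) (negPf y0) (negPf z0) /=.
case/or3P => /eqP ez; case/or3P => /eqP ey; case/or3P => /eqP ex;
  move: xy yz zx; rewrite ex ey ez ?eqxx // => _ _ _;
  by apply: (eq_mod2 (r := F + G)); ring.
Qed.

(** In degree [d], the lowest degree of the ideal, only the constant terms of
    the coefficients matter. *)
Lemma hcomp_span d (f g x : HBP) :
  order_ge d f -> order_ge d g -> x \is d.-homog -> ideal_gen [:: f; g] x ->
  x \in [:: 0; hcomp d f; hcomp d g; hcomp d f + hcomp d g].
Proof.
move=> hf hg hx /ideal_gen2P [p [q e]].
rewrite -(pihomog_dE hx) e pihomogD !hcompM_order // !inE.
have [->|->] := F2_cases p@_0%MM; have [->|->] := F2_cases q@_0%MM;
by rewrite ?scale0r ?scale1r ?addr0 ?add0r eqxx ?orbT.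
Qed.

(** Two generators leave room for an [F_2]-plane only in the lowest degree [d],
    where the whole orbit lives; an orbit that is not a fixed point has three
    distinct elements. *)
Lemma orbit_sum_eq0 d (x f g : HBP) : x \is d.-homog -> x != cyc x ->
  (forall h, ideal_gen (C3orbit x) h <-> ideal_gen [:: f; g] h) ->
  x + cyc x + cyc (cyc x) = 0.
Proof.
rewrite C3orbitE => hx xy J.
have hO t : t \in [:: x; cyc x; cyc (cyc x)] -> t \is d.-homog.
  by rewrite !inE => /or3P [] /eqP ->; rewrite ?cyc_dhomog.
have oO t : ideal_gen [:: x; cyc x; cyc (cyc x)] t -> order_ge d t.
  by apply: order_ge_ideal => u /hO /dhomog_order_ge.
have of_ : order_ge d f by apply/oO/J/ideal_gen_mem/mem_head.
have og : order_ge d g by apply/oO/J/ideal_gen_mem; rewrite !inE eqxx orbT.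
have x0 : x != 0 by apply: contraNneq xy => ->; rewrite cyc0.
have yz : cyc x != cyc (cyc x) by rewrite (inj_eq cyc_inj).
apply: (@sum_span2 (hcomp d f) (hcomp d g)); rewrite ?cyc_eq0 //.
  by move=> t tO; apply: hcomp_span (hO t tO) _ => //; apply/J/ideal_gen_mem.
by rewrite -{2}(cyc_iter3 x) (inj_eq cyc_inj).
Qed.

(** In a degree that exceeds the degrees of all members of the spanning family,
    the congruence for the power of [l] has no correction term left. *)
Lemma power_in_ideal d x (l : HBP) : x \is d.-homog -> l \is 1.-homog ->
  finite_dim_quotient (ideal_gen (C3orbit x)) ->
  exists N, ideal_gen (C3orbit x) (l ^+ N).
Proof.
move=> hx hl [s fin]; pose N := (\sum_(i < size s) msize s`_i)%N.
exists (N + d)%N; have [c] := fin (l ^+ (N + d)).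
have hlN : l ^+ (N + d) \is (N + d).-homog.
  by rewrite -[X in X.-homog]mul1n; apply: dhomogMn.
have s0 (i : 'I_(size s)) : hcomp (N + d) s`_i = 0.
  apply/mpolyP => m; rewrite hcompE mcoeff0; case: eqP => // em.
  apply: memN_msupp_eq0; apply/negP => /msize_mdeg_lt; rewrite em ltnNge.
  by rewrite /N (bigD1 i) //= -addnA leq_addr.
rewrite C3orbitE => /ideal_gen3P [p [q [r e]]].
have hO : [/\ x \is d.-homog, cyc x \is d.-homog & cyc (cyc x) \is d.-homog].
  by rewrite !cyc_dhomog.
case: hO => h1 h2 h3.
have -> : l ^+ (N + d) =
    hcomp N p * x + hcomp N q * cyc x + hcomp N r * cyc (cyc x).
  rewrite -!(@hcompM _ d) // -!pihomogD -e pihomogB (pihomog_dE hlN).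
  suff -> : hcomp (N + d) (\sum_(i < size s) c i *: s`_i) = 0 by rewrite subr0.
  by rewrite linear_sum big1 // => i _; rewrite linearZ /= s0 scaler0.
by do 2?[apply: ideal_genD]; apply: ideal_genM; apply: ideal_gen_mem;
  rewrite !inE eqxx ?orbT.
Qed.

(** As [w] divides a power of [b], it is nonzero modulo [a]; so in
    [a^m = w u] the factor [a] can be moved out of [u] until [m = 0]. *)
Lemma common_divisor_unit (w u v : HBP) m n :
  a ^+ m = w * u -> b ^+ n = w * v -> exists w', w * w' = 1.
Proof.
move=> ea eb; have kw : kill_a w != 0.
  apply/eqP => kw; have := congr1 kill_a eb.
  rewrite kill_aX kill_aM kw kill_a_b mul0r => /eqP.
  by rewrite expf_eq0 (negPf b_neq0) andbF.
elim: m u ea => [|m IH] u ea; first by exists u; rewrite -ea.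
have /eqP : kill_a w * kill_a u = 0.
  by rewrite -kill_aM -ea kill_aX kill_a_a expr0n.
rewrite mulf_eq0 (negPf kw) /= => /eqP /kill_a_dvd [t et].
apply: (IH t); apply: (mulfI a_neq0); rewrite -exprS ea et; ring.
Qed.

Lemma orbit_common_divisor d x w p q r :
  x \is d.-homog -> finite_dim_quotient (ideal_gen (C3orbit x)) ->
  x = w * p -> cyc x = w * q -> cyc (cyc x) = w * r ->
  exists w', w * w' = 1.
Proof.
move=> hx fin e1 e2 e3.
have dvd t : ideal_gen (C3orbit x) t -> exists u, t = w * u.
  rewrite C3orbitE => /ideal_gen3P [i [j [k ->]]].
  by exists (i * p + j * q + k * r); rewrite e3 e2 {1}e1; ring.
have [m /dvd [u eu]] := power_in_ideal hx dhomog_a fin.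
have [n /dvd [v ev]] := power_in_ideal hx dhomog_b fin.
exact: common_divisor_unit eu ev.
Qed.

(** Generators of positive degree exclude the constant [1]; the zero polynomial
    is homogeneous of every degree, so it is covered as well. *)
Lemma parameter_degree x : homogeneous x ->
  parameter_ideal (ideal_gen (C3orbit x)) ->
  exists2 d, (0 < d)%N & x \is d.-homog.
Proof.
move=> [[|d] hx] [[f [g [m [n [m0 n0 hf hg J]]]]] _]; last by exists d.+1.
exists 1%N => //; have -> : x = 0; last exact: rpred0.
apply: (dhomog_order_gt_eq0 hx (k := 1)) => //.
apply: (@order_ge_ideal 1 [:: f; g]); last by apply/J/ideal_gen_mem/mem_head.
by move=> t; rewrite !inE => /orP [] /eqP ->;
  [apply: (order_geW m0) | apply: (order_geW n0)]; apply: dhomog_order_ge.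
Qed.

Lemma Sq_closed_power k x : C3orbit x =i C3orbit (a ^+ (2 ^ k)) ->
  Steenrod_closed (ideal_gen (C3orbit x)).
Proof.
move=> O f [c ->].
have SqO t : t \in C3orbit x -> exists u, Sq t = u * t.
  rewrite O C3orbitE !inE => t_in; exists (1 + t); rewrite SqE.
  have F2 m (u v : HBP) : (u + v) ^+ (2 ^ m) = u ^+ (2 ^ m) + v ^+ (2 ^ m).
    by elim: m => // m IH; rewrite expnSr !exprM IH sqrfD.
  have lin l : l \is 1.-homog -> steen l = l + l ^+ 2.
    case/linear_cases => ->;
      rewrite ?steenD ?steen0 ?steen_a ?steen_b ?sqrfD //; ring.
  have [l hl ->] : exists2 l, l \is 1.-homog & t = l ^+ (2 ^ k).
    by case/or3P: t_in => /eqP ->; rewrite -?cycX;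
      [exists a | exists (cyc a) | exists (cyc (cyc a))];
      rewrite ?cycX ?cyc_dhomog ?dhomog_a.
  by rewrite steenX lin // F2 -exprM mulnC exprM; ring.
rewrite SqE; elim/big_rec: _ => [|i g _ IH].
  by rewrite steen0; apply: ideal_gen0.
rewrite steenD steenM; apply: ideal_genD => //; apply: ideal_genM.
have si := mem_nth 0 (ltn_ord i).
have [u] := SqO _ si; rewrite SqE => ->.
by apply/ideal_genM/ideal_gen_mem.
Qed.

Theorem theorem4p16 (x : {mpoly 'F_2[2]})
    (hx : homogeneous x)
    (hpar : parameter_ideal (ideal_gen (C3orbit x))) :
  Steenrod_closed (ideal_gen (C3orbit x)) <->
  exists k : nat, C3orbit x =i C3orbit (gen_a ^+ (2 ^ k)).
Proof.
split=> [closed|[k]]; last exact: Sq_closed_power.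
have [d d0 {}hx] := parameter_degree hx hpar.
have [[f [g [m [n [_ _ _ _ J]]]]] fin] := hpar.
(* A fixed point would generate a principal ideal, with common divisor [x]. *)
have xy : x != cyc x.
  apply/eqP => xy; have yz : cyc (cyc x) = x by rewrite -!xy.
  have [|||v] := @orbit_common_divisor _ _ x 1 1 1 hx fin; rewrite ?mulr1 //.
  exact: not_unit hx d0.
have tr := orbit_sum_eq0 hx xy J.
have ccx : cyc (cyc x) = x + cyc x by rewrite -(addf_eq0 tr).
have cop : is_coprime x (cyc x).
  move=> w p q ep eq; apply: (orbit_common_divisor (r := p + q) hx fin ep eq).
  by rewrite ccx mulrDr -ep -eq.
(* The third generator is the sum of the other two, hence [p + r] and [q + r]
   below. *)
have [p [q [r e]]] : exists p q r,
    steen x = p * x + q * cyc x + r * cyc (cyc x).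
  apply: ideal_gen3P; rewrite -C3orbitE -SqE; apply: closed.
  exact/ideal_gen_mem/mem_head.
have [|l [k [hl l0 ->]]] :=
  closed_orbit_power (p := p + r) (q := q + r) d0 hx tr cop.
  by rewrite e ccx; ring.
exists k; case: (linear_cases hl) l0 => ->.
- by rewrite eqxx.
- by [].
- by rewrite -cyc_a -cycX => _; apply: C3orbit_cyc.
- rewrite -cyc_b -cyc_a -2!cycX => _ y.
  exact: etrans (C3orbit_cyc (cyc _) y) (C3orbit_cyc _ y).
Qed.
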